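(* Let $\mathfrak{M}_o$ be the unital $*$-algebra generated by the monotone annihilators $\{a_i\mid i\in\mathbb{Z}\}$ acting on the discrete monotone Fock space. Then the family $\{X_\lambda\}_{\lambda\in\Gamma}$ of all $\lambda$-forms other than the words $a_i^\dagger a_i$, $i\in\mathbb{Z}$, together with the family $\{a_ia_i^\dagger\}_{i\in\mathbb{Z}}$, forms a Hamel (linear) basis of $\mathfrak{M}_o$.
   Context: For $k\ge 1$ let $I_k=\{(i_1,\dots,i_k)\mid i_1<\cdots<i_k,\ i_j\in\mathbb{Z}\}$. The discrete monotone Fock space is the Hilbert space $\mathcal{F}_m=\bigoplus_{k=0}^\infty\mathcal{H}_k$ with $\mathcal{H}_0=\mathbb{C}\Omega$ and $\mathcal{H}_k=\ell^2(I_k)$ for $k\ge1$. Its canonical orthonormal basis consists of the vectors $e_{(i_1,\dots,i_k)}$, with $e_\emptyset=\Omega$. For $i\in\mathbb{Z}$ the monotone creator and annihilator are the mutually adjoint bounded operators on $\mathcal{F}_m$ given by $$a_i^\dagger e_{(i_1,\dots,i_k)}=\begin{cases}e_{(i,i_1,\dots,i_k)}&\text{if } i<i_1,\\0&\text{otherwise,}\end{cases}\qquad a_i e_{(i_1,\dots,i_k)}=\begin{cases}e_{(i_2,\dots,i_k)}&\text{if } k\ge1,\ i=i_1,\\0&\text{otherwise,}\end{cases}$$ with $a_i^\dagger\Omega=e_{(i)}$. $\mathfrak{M}_o\subset\mathcal{B}(\mathcal{F}_m)$ is the unital $*$-algebra generated by $\{a_i\}_{i\in\mathbb{Z}}$.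 A $\lambda$-form is a word $a_{i_1}^\dagger\cdots a_{i_m}^\dagger a_{j_1}\cdots a_{j_n}$ with $m,n\ge0$, $i_1<\cdots<i_m$ and $j_1>\cdots>j_n$; for $m=n=0$ it is the identity $I$. Let $\Lambda$ be the index set of all $\lambda$-forms, so that $\lambda\in\Lambda$ can be identified with the pair of finite subsets $(\{i_1,\dots,i_m\},\{j_n,\dots,j_1\})$ of $\mathbb{Z}$, possibly empty. $\Gamma\subset\Lambda$ is obtained by removing the indices of the $\lambda$-forms $a_i^\dagger a_i$, $i\in\mathbb{Z}$ (i.e. removing the pairs $(\{i\},\{i\})$). In particular $I$ belongs to the family indexed by $\Gamma$. *)

(* Defs.v *)
From HB Require Import structures.
From mathcomp Require Import all_boot all_order all_algebra complex.
From mathcomp Require Import boolp classical_sets functions fsbigop reals ereal.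
From mathcomp Require Import esum.
From mathcomp Require Import ring.

Set Implicit Arguments.
Unset Strict Implicit.
Unset Printing Implicit Defensive.

Import Order.TTheory GRing.Theory Num.Theory.
Import Normc.

Local Open Scope classical_set_scope.
Local Open Scope ring_scope.
Local Open Scope complex_scope.

Section UnorderedSums.
Variables (R : realType) (I : choiceType).

(* The sum over I of an absolutely summable family; without absolute
   summability the value carries no meaning. *)
Definition rsum (f : I -> R) : R :=
  fine (\esum_(i in [set: I]) (Num.max (f i) 0)%:E) -
  fine (\esum_(i in [set: I]) (Num.max (- f i) 0)%:E).

Definition csum (f : I -> R[i]) : R[i] :=
  rsum (fun i => complex.Re (f i)) +i* rsum (fun i => complex.Im (f i)).

End UnorderedSums.

Section L2.
Variables (R : realType) (I : choiceType).

Definition sqnorm_sum (f : I -> R[i]^o) : \bar R :=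
  \esum_(i in [set: I]) (normc (f i) ^+ 2)%:E.

Definition square_summable (f : I -> R[i]^o) : bool :=
  `[< (sqnorm_sum f < +oo)%E >].

Lemma sqnorm_sum_ge0 f : (0 <= sqnorm_sum f)%E.
Proof. by apply: esum_ge0 => i _; rewrite lee_fin sqr_ge0. Qed.

Lemma sqnorm_sumD (f g : I -> R[i]^o) : (sqnorm_sum (f + g)%R <=
  (sqnorm_sum f + sqnorm_sum f) + (sqnorm_sum g + sqnorm_sum g))%E.
Proof.
have h0 (h : I -> R[i]^o) i : [set: I] i -> (0 <= (normc (h i) ^+ 2)%:E)%E.
  by move=> _; rewrite lee_fin sqr_ge0.
have h2 (h : I -> R[i]^o) i :
  [set: I] i -> (0 <= (normc (h i) ^+ 2)%:E + (normc (h i) ^+ 2)%:E)%E.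
  by move=> Ii; rewrite adde_ge0 // h0.
rewrite /sqnorm_sum -!esumD; [|exact: h2|exact: h2|exact: h0..].
apply: le_esum => i _; rewrite -!EFinD lee_fin.
have := le_normcD (f i) (g i); rewrite [f i + g i]/((f + g) i) => le_fg.
have n0 (z : R[i]) : 0 <= normc z by case: z => a b; exact: sqrtr_ge0.
apply: (le_trans (lerXn2r 2 _ _ le_fg)); rewrite ?nnegrE ?addr_ge0 ?n0 //.
set a := normc (f i); set b := normc (g i).
rewrite -subr_ge0 (_ : _ - _ = (a - b) ^+ 2) ?sqr_ge0 //; ring.
Qed.

Lemma sqnorm_sumZ (a : R[i]) (f : I -> R[i]^o) :
  (sqnorm_sum (a *: f)%R <= (normc a ^+ 2)%:E * sqnorm_sum f)%E.
Proof.
apply: ge_ereal_sup => _ [A AI <-].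
under eq_fsbigr => i _ do
  rewrite [(a *: f) i]/(a * f i) normcM exprMn EFinM.
rewrite -ge0_mule_fsumr; last by move=> i; rewrite lee_fin sqr_ge0.
apply: lee_pmul => //; first by rewrite lee_fin sqr_ge0.
  by apply: fsume_ge0 => i _; rewrite lee_fin sqr_ge0.
by apply: esum_ge; exists A.
Qed.

Lemma square_summable_submod : submod_closed square_summable.
Proof.
split=> [|a f g].
  apply/asboolP; rewrite /sqnorm_sum esum1 ?ltry // => i _.
  by rewrite normc0 expr0n.
move=> /asboolP f_lty /asboolP g_lty; apply/asboolP.
apply: le_lt_trans (sqnorm_sumD _ _) _.
have af_lty : (sqnorm_sum (a *: f)%R < +oo)%E.
  apply: le_lt_trans (sqnorm_sumZ _ _) _.
  by rewrite lte_mul_pinfty // lee_fin sqr_ge0.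
by rewrite !lte_add_pinfty.
Qed.

HB.instance Definition _ := GRing.isSubmodClosed.Build R[i] (I -> R[i]^o)
  square_summable square_summable_submod.

Record l2 := L2 { l2_fun :> I -> R[i]^o ; l2_funP : square_summable l2_fun }.

HB.instance Definition _ := [isSub for l2_fun].
HB.instance Definition _ := [Choice of l2 by <:].
HB.instance Definition _ := [SubChoice_isSubLmodule of l2 by <:].

(* Linear in the first argument. *)
Definition dot (x y : l2) : R[i] := csum (fun i => x i * (y i)^*).

Definition l2norm (x : l2) : R := Num.sqrt (fine (sqnorm_sum x)).

End L2.

Section PartialInjection.
Variables (R : realType) (I : choiceType).
Variables (p q : I -> option I).
Hypothesis pqP : forall s t, p s = Some t <-> q t = Some s.

Lemma esum_pinj (H : I -> I -> \bar R) :
  \esum_(s in [set: I]) oapp (H s) 0%E (p s) =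
  \esum_(t in [set: I]) oapp (H^~ t) 0%E (q t).
Proof.
pose P := [set s | exists t, p s = Some t].
pose Q := [set t | exists s, q t = Some s].
pose e s := odflt s (p s).
have e_bij : set_bij P Q e.
  split=> [s [t pst]|s s'|t [s qts]].
  - by exists s; rewrite /e pst; apply/pqP.
  - rewrite !inE => -[t pst] [t' pst']; rewrite /e pst pst' /= => ett'.
    by move: pst pst'; rewrite ett' => /pqP qs /pqP; rewrite qs => -[].
  - by move/pqP: qts => pst; exists s; [exists t|rewrite /e pst].
have restr (K : set I) (f : I -> \bar R) : (forall s, ~ K s -> f s = 0%E) ->
    \esum_(s in [set: I]) f s = \esum_(s in K) f s.
  move=> f0; rewrite [RHS]esum_mkcond; apply: eq_esum => s _.
  by case: ifPn => // /negP; rewrite inE => /f0.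
rewrite (restr P); last first.
  by move=> s nPs; case E: (p s) => [t|] //; case: nPs; exists t.
rewrite (restr Q); last first.
  by move=> t nQt; case E: (q t) => [s|] //; case: nQt; exists s.
rewrite (reindex_esum _ _ _ _ e_bij); apply: eq_esum => s [t pst].
by rewrite /e pst /=; move/pqP: pst => ->.
Qed.

Definition pinj_fun (f : I -> R[i]^o) : I -> R[i]^o := fun s => oapp f 0 (p s).

Lemma sqnorm_sum_pinj (f : I -> R[i]^o) :
  (sqnorm_sum (pinj_fun f) <= sqnorm_sum f)%E.
Proof.
pose H (s t : I) : \bar R := (normc (f t) ^+ 2)%:E.
rewrite [leLHS](_ : _ = \esum_(s in [set: I]) oapp (H s) 0%E (p s)); last first.
  apply: eq_esum => s _; rewrite /pinj_fun; case: (p s) => //=.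
  by rewrite !expr0n addr0 sqrtr0 expr0n.
rewrite esum_pinj; apply: le_esum => t _; case: (q t) => //=.
by rewrite lee_fin sqr_ge0.
Qed.

Lemma square_summable_pinj (x : l2 R I) : square_summable (pinj_fun x).
Proof.
have /asboolP x_lty := l2_funP x; apply/asboolP.
exact: le_lt_trans (sqnorm_sum_pinj x) x_lty.
Qed.

Definition pinj_op (x : l2 R I) : l2 R I := L2 (square_summable_pinj x).

Lemma l2norm_pinj x : l2norm (pinj_op x) <= l2norm x.
Proof.
rewrite /l2norm ler_wsqrtr // fine_le ?sqnorm_sum_pinj //.
  by rewrite ge0_fin_numE ?sqnorm_sum_ge0 //; have /asboolP := l2_funP (pinj_op x).
by rewrite ge0_fin_numE ?sqnorm_sum_ge0 //; have /asboolP := l2_funP x.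
Qed.

Lemma pinj_linear : linear pinj_op.
Proof.
move=> a x y; apply: val_inj; apply/funext => s /=.
rewrite -[LHS]/(oapp ((a *: x + y : l2 R I) : I -> R[i]^o) 0 (p s)).
rewrite -[RHS]/(a * oapp x 0 (p s) + oapp y 0 (p s)).
by case: (p s) => [t|] //=; rewrite mulr0 addr0.
Qed.

Lemma rsum_pinj (H : I -> I -> R) :
  rsum (fun s => oapp (H s) 0 (p s)) = rsum (fun t => oapp (H^~ t) 0 (q t)).
Proof.
rewrite /rsum; congr (fine _ - fine _).
- rewrite [RHS](eq_esum (b := fun t => oapp
    (fun s => (Num.max (H s t) 0)%:E) 0%E (q t))); last first.
    by move=> t _; case: (q t) => //=; rewrite maxxx.
  rewrite -(esum_pinj (fun s t => (Num.max (H s t) 0)%:E)).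
  by apply: eq_esum => s _; case: (p s) => //=; rewrite maxxx.
- rewrite [RHS](eq_esum (b := fun t => oapp
    (fun s => (Num.max (- H s t) 0)%:E) 0%E (q t))); last first.
    by move=> t _; case: (q t) => //=; rewrite oppr0 maxxx.
  rewrite -(esum_pinj (fun s t => (Num.max (- H s t) 0)%:E)).
  by apply: eq_esum => s _; case: (p s) => //=; rewrite oppr0 maxxx.
Qed.

Lemma csum_pinj (H : I -> I -> R[i]) :
  csum (fun s => oapp (H s) 0 (p s)) = csum (fun t => oapp (H^~ t) 0 (q t)).
Proof.
rewrite /csum; congr (_ +i* _).
- rewrite (_ : (fun s => _) =
    fun s => oapp (fun t => complex.Re (H s t)) 0 (p s)); last first.
    by apply/funext => s; case: (p s).
  by rewrite rsum_pinj; congr rsum; apply/funext => t; case: (q t).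
- rewrite (_ : (fun s => _) =
    fun s => oapp (fun t => complex.Im (H s t)) 0 (p s)); last first.
    by apply/funext => s; case: (p s).
  by rewrite rsum_pinj; congr rsum; apply/funext => t; case: (q t).
Qed.

End PartialInjection.

Section BoundedOperators.
Variables (R : realType) (I : choiceType).
Implicit Types T : l2 R I -> l2 R I.

Definition bounded_linear T : bool :=
  `[< linear T /\ exists M : R, forall x, l2norm (T x) <= M * l2norm x >].

Lemma l2norm_sq (x : l2 R I) : l2norm x ^+ 2 = fine (sqnorm_sum x).
Proof. by rewrite sqr_sqrtr // fine_ge0 // sqnorm_sum_ge0. Qed.

Lemma l2normD (x y : l2 R I) :
  l2norm (x + y) ^+ 2 <= 2 * (l2norm x ^+ 2 + l2norm y ^+ 2).
Proof.
have fn (z : l2 R I) : sqnorm_sum z \is a fin_num.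
  by rewrite ge0_fin_numE ?sqnorm_sum_ge0 //; have /asboolP := l2_funP z.
rewrite !l2norm_sq -lee_fin fineK //.
apply: (@le_trans _ _ _ _ _ (sqnorm_sumD x y)).
rewrite -(fineK (fn x)) -(fineK (fn y)) -!EFinD lee_fin /=.
by rewrite -!mulr2n -mulrnDl mulr_natl.
Qed.

Lemma l2normZ (a : R[i]) (x : l2 R I) :
  l2norm (a *: x) ^+ 2 <= (normc a * l2norm x) ^+ 2.
Proof.
have fn (z : l2 R I) : sqnorm_sum z \is a fin_num.
  by rewrite ge0_fin_numE ?sqnorm_sum_ge0 //; have /asboolP := l2_funP z.
rewrite exprMn !l2norm_sq -lee_fin fineK //.
apply: (@le_trans _ _ _ _ _ (sqnorm_sumZ a x)).
by rewrite -(fineK (fn x)) -EFinM.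
Qed.

Lemma bounded_linear_submod : submod_closed bounded_linear.
Proof.
split=> [|a S T].
  apply/asboolP; split=> [b x y|]; first by rewrite scaler0 addr0.
  exists 1 => x; rewrite mul1r.
  rewrite (_ : l2norm _ = 0) ?sqrtr_ge0 // /l2norm /sqnorm_sum esum1 ?sqrtr0 //.
  by move=> i _; rewrite normc0 expr0n.
move=> /asboolP[linS [M SM]] /asboolP[linT [N TN]]; apply/asboolP; split.
  move=> b x y.
  rewrite -[LHS]/(a *: S (b *: x + y) + T (b *: x + y)).
  rewrite -[RHS]/(b *: (a *: S x + T x) + (a *: S y + T y)).
  rewrite linS linT !scalerDr !scalerA (mulrC a) -!addrA; congr (_ + _).
  by rewrite addrCA.
pose K := 2 * ((normc a * M) ^+ 2 + N ^+ 2).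
have K0 : 0 <= K by rewrite mulr_ge0 // addr_ge0 // sqr_ge0.
exists (Num.sqrt K) => x; have x0 := sqrtr_ge0 (fine (sqnorm_sum x)).
rewrite -/(l2norm x) in x0.
have n0 (z : R[i]) : 0 <= normc z by case: z => ? ?; exact: sqrtr_ge0.
rewrite -(@ler_pXn2r _ 2) ?nnegrE ?sqrtr_ge0 ?mulr_ge0 ?sqrtr_ge0 //.
rewrite -[(a *: S + T) x]/(a *: S x + T x) exprMn (sqr_sqrtr K0).
apply: le_trans (l2normD _ _) _; rewrite /K -mulrA ler_pM2l // mulrDl lerD //.
  apply: le_trans (l2normZ _ _) _; rewrite -exprMn lerXn2r ?nnegrE //.
  - by rewrite mulr_ge0 // sqrtr_ge0.
  - by rewrite -mulrA mulr_ge0 // (le_trans _ (SM x)) // sqrtr_ge0.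
  - by rewrite -mulrA ler_wpM2l.
rewrite -exprMn lerXn2r ?nnegrE ?sqrtr_ge0 //.
by rewrite (le_trans _ (TN x)) // sqrtr_ge0.
Qed.

HB.instance Definition _ := GRing.isSubmodClosed.Build R[i]
  (l2 R I -> l2 R I) bounded_linear bounded_linear_submod.

Record bop :=
  Bop { bop_fun :> l2 R I -> l2 R I ; bop_funP : bounded_linear bop_fun }.

HB.instance Definition _ := [isSub for bop_fun].
HB.instance Definition _ := [Choice of bop by <:].
HB.instance Definition _ := [SubChoice_isSubLmodule of bop by <:].

Definition adjoint (S T : bop) : Prop :=
  forall x y : l2 R I, dot (S x) y = dot x (T y).

End BoundedOperators.

(* The index sets I_k for all k >= 0 together, the empty sequence being the
   index of the vacuum; the Hilbert sum of the H_k = l2(I_k) is l2 of the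
   disjoint union of the I_k. *)
Definition incseq : Type := {s : seq int | sorted (fun i j => i < j) s}.

HB.instance Definition _ := Choice.on incseq.

Definition vacuum : incseq := exist _ [::] isT.

Definition mfock (R : realType) : Type := l2 R incseq.

HB.instance Definition _ (R : realType) := GRing.Lmodule.on (mfock R).

Section Basis.
Variables (R : realType) (I : choiceType).

Definition delta (s : I) : I -> R[i]^o := fun t => (t == s)%:R.

Lemma square_summable_delta s : square_summable (delta s).
Proof.
apply/asboolP; rewrite /sqnorm_sum (esumID [set s]); last first.
  by move=> *; rewrite lee_fin sqr_ge0.
rewrite setTI esum_set1 ?lee_fin ?sqr_ge0 // esum1 ?adde0 ?ltry //.
move=> t [_ /= /eqP/negPf ts]; rewrite /delta ts.
by rewrite /= !expr0n addr0 sqrtr0 expr0n.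
Qed.

Definition ebasis (s : I) : l2 R I := L2 (square_summable_delta s).

End Basis.

Lemma dotxx (R : realType) (I : choiceType) (x : l2 R I) :
  dot x x = (l2norm x ^+ 2)%:C.
Proof.
have E i : x i * (x i)^* = (normc (x i) ^+ 2)%:C.
  by rewrite -sqr_normc normc_def -rmorphXn; case: (x i).
rewrite /dot /csum /rsum; congr (_ +i* _).
  rewrite l2norm_sq /sqnorm_sum -[RHS]subr0; congr (_ - _).
    by congr fine; apply: eq_esum => i _; rewrite E /= max_l // sqr_ge0.
  by rewrite esum1 // => i _; rewrite E /= max_r // oppr_le0 sqr_ge0.
by rewrite !esum1 ?subrr // => i _; rewrite E /= ?oppr0 maxxx.
Qed.

Lemma dot_ebasis (R : realType) (I : choiceType) (x : l2 R I) (s : I) :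
  dot x (ebasis R s) = x s.
Proof.
have sum1 (f : I -> R) : (forall t, t != s -> f t = 0) -> rsum f = f s.
  move=> f0; pose g (h : R -> R) t : \bar R := (Num.max (h (f t)) 0)%:E.
  have gE h : h 0 = 0 -> \esum_(t in [set: I]) g h t = g h s.
    move=> h0; rewrite (esumID [set s]); last first.
      by move=> *; rewrite lee_fin le_max lexx orbT.
    rewrite setTI esum_set1 ?lee_fin ?le_max ?lexx ?orbT // esum1 ?adde0 //.
    by move=> t [_ /= /eqP ts]; rewrite /g f0 // h0 maxxx.
  rewrite /rsum (gE id) // (gE -%R) ?oppr0 // /g /=.
  case: (leP 0 (f s)) => fs0; first by rewrite max_r ?oppr_le0 // subr0.
  by rewrite max_l ?oppr_ge0 ?ltW // sub0r opprK.
rewrite /dot /csum !sum1 => [|t ts|t ts]; last 2 first.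
- by rewrite /= /delta (negPf ts) rmorph0 mulr0.
- by rewrite /= /delta (negPf ts) rmorph0 mulr0.
by rewrite /= /delta eqxx rmorph1 mulr1; case: (x s).
Qed.

Arguments delta R {I} s.
Arguments ebasis R {I} s.

Section BoundedOperatorAlgebra.
Variable R : realType.

Definition mbop : Type := bop R incseq.

HB.instance Definition _ := GRing.Lmodule.on mbop.

Implicit Types S T U : mbop.

Lemma id_bounded : bounded_linear (@id (mfock R)).
Proof. by apply/asboolP; split=> //; exists 1 => x; rewrite mul1r. Qed.

Lemma comp_bounded S T : bounded_linear (S \o T).
Proof.
have /asboolP[linS [M SM]] := bop_funP S.
have /asboolP[linT [N TN]] := bop_funP T.
apply/asboolP; split=> [a x y|]; first by rewrite /= linT linS.
exists (`|M| * N) => x /=; apply: le_trans (SM _) _.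
apply: (@le_trans _ _ (`|M| * l2norm (T x))).
  by rewrite ler_wpM2r ?sqrtr_ge0 // ler_norm.
by rewrite -mulrA ler_wpM2l.
Qed.

Definition bop1 : mbop := Bop id_bounded.
Definition bopM S T : mbop := Bop (comp_bounded S T).

Lemma bopMA : associative bopM.
Proof. by move=> S T U; apply: val_inj. Qed.

Lemma bop1M : left_id bop1 bopM.
Proof. by move=> S; apply: val_inj. Qed.

Lemma bopM1 : right_id bop1 bopM.
Proof. by move=> S; apply: val_inj. Qed.

Lemma bopMDl : left_distributive bopM +%R.
Proof. by move=> S T U; apply: val_inj. Qed.

Lemma bopMDr : right_distributive bopM +%R.
Proof.
move=> S T U; apply: val_inj; apply/funext => x.
have /asboolP[linS _] := bop_funP S.
rewrite -[LHS]/(S (T x + U x)) -[RHS]/(S (T x) + S (U x)).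
by have := linS 1 (T x) (U x); rewrite !scale1r.
Qed.

Lemma bop1_neq0 : bop1 != 0.
Proof.
apply/eqP => /(congr1 (fun S : mbop => S (ebasis R vacuum) vacuum)).
rewrite -[LHS]/(delta R vacuum vacuum) -[RHS]/(0 : R[i]) /delta eqxx.
by move/eqP; rewrite oner_eq0.
Qed.

HB.instance Definition _ := GRing.Zmodule_isNzRing.Build mbop
  bopMA bop1M bopM1 bopMDl bopMDr bop1_neq0.

Lemma bopZAl (a : R[i]) S T : a *: (S * T) = (a *: S) * T.
Proof. by apply: val_inj. Qed.

HB.instance Definition _ := GRing.Lmodule_isLalgebra.Build R[i] mbop bopZAl.

Lemma bopZAr (a : R[i]) S T : a *: (S * T) = S * (a *: T).
Proof.
apply: val_inj; apply/funext => x.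
have /asboolP[linS _] := bop_funP S.
rewrite -[LHS]/(a *: S (T x)) -[RHS]/(S (a *: T x)).
have S0 : S 0 = 0 by have := linS (-1) 0 0; rewrite scaler0 add0r scaleN1r addNr.
by have := linS a (T x) 0; rewrite S0 !addr0.
Qed.

HB.instance Definition _ := GRing.Lalgebra_isAlgebra.Build R[i] mbop bopZAr.

End BoundedOperatorAlgebra.

Section Monotone.
Variables (R : realType) (i : int).

(* cons_seq maps (i_1, ..., i_k) to (i, i_1, ..., i_k) when i < i_1, and
   uncons_seq maps (i, i_2, ..., i_k) to (i_2, ..., i_k); elsewhere both are
   undefined. *)
Definition cons_seq (s : incseq) : option incseq := insub (i :: val s).

Definition uncons_seq (s : incseq) : option incseq :=
  if val s is j :: t then if j == i then insub t else None else None.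

Lemma cons_seqP s t : cons_seq s = Some t <-> val t = i :: val s.
Proof.
rewrite /cons_seq; split=> [|tis].
  by case: insubP => // u _ us [<-].
by rewrite -tis valK.
Qed.

Lemma uncons_seqP s t : uncons_seq s = Some t <-> val s = i :: val t.
Proof.
rewrite /uncons_seq; split=> [|->]; last by rewrite eqxx valK.
case: (val s) => // j u; case: eqP => // ->.
by case: insubP => // v _ vu [<-]; rewrite vu.
Qed.

Lemma cons_unconsP s t : cons_seq s = Some t <-> uncons_seq t = Some s.
Proof. by rewrite cons_seqP uncons_seqP. Qed.

Lemma uncons_consP s t : uncons_seq s = Some t <-> cons_seq t = Some s.
Proof. by rewrite cons_seqP uncons_seqP. Qed.

(* In coordinates, (creator x) s = x (uncons_seq s) and
   (annihilator x) s = x (cons_seq s), read as 0 where undefined; see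
   creator_ebasis and annihilator_ebasis for the action on the basis. *)
Lemma creator_bounded : bounded_linear (@pinj_op R _ _ _ uncons_consP).
Proof.
apply/asboolP; split; first exact: pinj_linear.
by exists 1 => x; rewrite mul1r l2norm_pinj.
Qed.

Lemma annihilator_bounded : bounded_linear (@pinj_op R _ _ _ cons_unconsP).
Proof.
apply/asboolP; split; first exact: pinj_linear.
by exists 1 => x; rewrite mul1r l2norm_pinj.
Qed.

Definition creator : mbop R := Bop creator_bounded.

Definition annihilator : mbop R := Bop annihilator_bounded.

Lemma creator_ebasis s :
  creator (ebasis R s) = oapp (ebasis R) 0 (cons_seq s).
Proof.
apply: val_inj; apply/funext => t.
rewrite -[LHS]/(oapp (delta R s) 0 (uncons_seq t)).
case E: (cons_seq s) => [u|] /=.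
  rewrite -[RHS]/(delta R u t) /delta.
  case F: (uncons_seq t) => [v|] /=.
    congr (_%:R); congr nat_of_bool; apply/eqP/eqP => [vs|tu].
      by move/uncons_consP: F; rewrite vs E => -[].
    by move/cons_unconsP: E; rewrite -tu F => -[].
  by case: eqP => // tu; move/cons_unconsP: E; rewrite -tu F.
rewrite -[RHS]/(0 : R[i]^o); case F: (uncons_seq t) => [v|] //=.
by rewrite /delta; case: eqP => // vs; move/uncons_consP: F; rewrite vs E.
Qed.

Lemma annihilator_ebasis s :
  annihilator (ebasis R s) = oapp (ebasis R) 0 (uncons_seq s).
Proof.
apply: val_inj; apply/funext => t.
rewrite -[LHS]/(oapp (delta R s) 0 (cons_seq t)).
case E: (uncons_seq s) => [u|] /=.
  rewrite -[RHS]/(delta R u t) /delta.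
  case F: (cons_seq t) => [v|] /=.
    congr (_%:R); congr nat_of_bool; apply/eqP/eqP => [vs|tu].
      by move/cons_unconsP: F; rewrite vs E => -[].
    by move/uncons_consP: E; rewrite -tu F => -[].
  by case: eqP => // tu; move/uncons_consP: E; rewrite -tu F.
rewrite -[RHS]/(0 : R[i]^o); case F: (cons_seq t) => [v|] //=.
by rewrite /delta; case: eqP => // vs; move/cons_unconsP: F; rewrite vs E.
Qed.

Lemma annihilator_adjoint : adjoint annihilator creator.
Proof.
move=> x y; rewrite /dot.
pose H (s t : incseq) : R[i] := x t * (y s)^*.
rewrite (_ : (fun s => _) = fun s => oapp (H s) 0 (cons_seq s)); last first.
  apply/funext => s; rewrite -[(annihilator x) s]/(oapp x 0 (cons_seq s)).
  by case: (cons_seq s) => //=; rewrite mul0r.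
rewrite (csum_pinj cons_unconsP); congr csum; apply/funext => t.
rewrite -[(creator y) t]/(oapp y 0 (uncons_seq t)).
by case: (uncons_seq t) => //=; rewrite rmorph0 mulr0.
Qed.

End Monotone.

Section MonotoneAlgebra.
Variable R : realType.

Definition unital_star_subalgebra (S : set (mbop R)) : Prop :=
  [/\ S 1,
      forall (a : R[i]) x y, S x -> S y -> S (a *: x + y),
      forall x y, S x -> S y -> S (x * y) &
      forall x y, S x -> adjoint x y -> S y].

Definition monotone_algebra : set (mbop R) :=
  smallest unital_star_subalgebra (range (@annihilator R)).

(* (s, t) encodes the word with creators indexed by s in increasing order,
   followed by annihilators indexed by t in decreasing order. *)
Definition lform (l : incseq * incseq) : mbop R :=
  (\prod_(i <- val l.1) creator R i) *
  (\prod_(j <- rev (val l.2)) annihilator R j).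

End MonotoneAlgebra.

Definition in_Gamma (l : incseq * incseq) : bool :=
  match val l.1, val l.2 with
  | [:: i], [:: j] => i != j
  | _, _ => true
  end.

Definition Gamma : Type := {l : incseq * incseq | in_Gamma l}.

HB.instance Definition _ := Choice.on Gamma.

Definition hamel_basis (K : fieldType) (V : lmodType K) (W : set V)
    (J : eqType) (v : J -> V) : Prop :=
  [/\ forall j, W (v j),
      forall (s : seq J) (c : J -> K), uniq s ->
        \sum_(j <- s) c j *: v j = 0 -> forall j, j \in s -> c j = 0 &
      forall x, W x ->
        exists (s : seq J) (c : J -> K), x = \sum_(j <- s) c j *: v j].

(* Main.v *)
Require Import Defs.
From mathcomp Require Import all_boot all_order all_algebra complex.
From mathcomp Require Import boolp classical_sets functions fsbigop reals ereal.
From mathcomp Require Import esum numfun.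
From mathcomp Require Import ring lra zify.

(** Write P_i = a_i a_i^† for the projection onto the span of the e_s whose
    entries all exceed i, and Q_i = a_i^† a_i for the projection onto the span
    of the e_s with first entry i. Since Q_(i+1) = P_i - P_(i+1)
    ([number_telescope]), the excluded words Q_i still lie in the span of the
    proposed basis.

    That span contains the annihilators, so it exhausts the algebra as soon as
    it is a unital *-subalgebra. For products it suffices to multiply a basis
    element on the left by a single creator or annihilator
    ([basis_span_creatorM], [basis_span_annihilatorM]). Most such products are
    a word, a projection P_i or 0; the remaining ones have the shape P_j w or
    w P_j, where P_j would be absorbed into w if j were replaced by some smaller
    i, and P_j = P_i - Q_(i+1) - ... - Q_j turns them into finite sums of words
    ([basis_span_telescope]). For adjoints, the adjoint of a word is a word,
    P_i is self-adjoint, and adjoints are conjugate-linear and unique.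

    For linear independence one looks at matrix entries. The word with
    creators s and annihilators t has entry 1 at (s ++ v, t ++ v) for every v
    such that both sequences increase, and 0 elsewhere; P_i has entry 1 at
    (s, s) exactly when all entries of s exceed i. Among the basis elements
    only I and the P_i are nonzero at ([:: k], [:: k]), because Q_k has been
    removed; comparing the entries at k + 1 and at k isolates the coefficient
    of P_k. Once these vanish, the entry at (s, t) involves the word (s, t) and
    words with fewer creators only, and induction on the length of s concludes.

    Operators are compared through the coordinates of their values, indexed by
    arbitrary integer sequences and extended by 0 outside the increasing ones
    ([fcoord]): creators and annihilators then act by plain list surgery. *)

Set Implicit Arguments.
Unset Strict Implicit.
Unset Printing Implicit Defensive.

Import Order.TTheory GRing.Theory Num.Theory.
Import Normc.

Local Open Scope classical_set_scope.
Local Open Scope ring_scope.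
Local Open Scope complex_scope.

(** * Linearity of unordered sums *)

Section RealSums.
Variables (R : realType) (I : choiceType).
Implicit Types f g a b : I -> R.

Let rsummable f := summable [set: I] (EFin \o f).

Lemma le_rsummable f g :
  (forall i, `|f i| <= g i) -> rsummable g -> rsummable f.
Proof.
move=> fg; apply: le_lt_trans; apply: le_esum => i _ /=.
by rewrite lee_fin (le_trans (fg i)) // ler_norm.
Qed.

(** [rsum] is defined from the positive and negative parts of the family;
    additivity needs the freedom to use any other splitting into nonnegative
    summable families. *)
Lemma rsum_subE a b : (forall i, 0 <= a i) -> (forall i, 0 <= b i) ->
  rsummable a -> rsummable b ->
  rsum (fun i => a i - b i) =
    fine (\esum_(i in [set: I]) (a i)%:E) -
    fine (\esum_(i in [set: I]) (b i)%:E).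
Proof.
move=> a0 b0 sa sb.
have fin f : (forall i, 0 <= f i) -> rsummable f ->
    \esum_(i in [set: I]) (f i)%:E \is a fin_num.
  move=> f0; rewrite /rsummable summableE; congr (_ \is a _).
  by apply: eq_esum => i _ /=; rewrite ger0_norm.
have := esumB sa sb (fun i _ => a0 i) (fun i _ => b0 i).
rewrite (eq_esum (b := fun i => (Num.max (a i - b i) 0)%:E)); last first.
  by move=> i _; rewrite funeposE -EFin_max.
rewrite [X in (_ - X)%E](eq_esum
  (b := fun i => (Num.max (- (a i - b i)) 0)%:E)); last first.
  by move=> i _; rewrite funenegE -EFin_max.
move=> /(congr1 fine); rewrite [RHS in _ = RHS -> _]fineB ?fin // => <-.
rewrite fineB //.
- apply: fin; first by move=> i; rewrite le_max lexx orbT.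
  apply: (@le_rsummable _ a) sa => i.
  rewrite ger0_norm ?le_max ?lexx ?orbT // ge_max a0 andbT.
  by rewrite lerBlDr lerDl.
- apply: fin; first by move=> i; rewrite le_max lexx orbT.
  apply: (@le_rsummable _ b) sb => i.
  rewrite ger0_norm ?le_max ?lexx ?orbT // ge_max b0 andbT.
  by rewrite opprB lerBlDr lerDl.
Qed.

Let pos f i := Num.max (f i) 0.

Let pos_ge0 f i : 0 <= pos f i. Proof. by rewrite le_max lexx orbT. Qed.

Let pos_sub f : f = (fun i => pos f i - pos (fun i => - f i) i).
Proof.
apply/funext => i; rewrite /pos; case: (leP (f i) 0) => ?.
  by rewrite max_l ?oppr_ge0 // sub0r opprK.
by rewrite max_r ?subr0 // oppr_le0 ltW.
Qed.

Let pos_summable f : rsummable f -> rsummable (pos f).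
Proof.
apply: le_lt_trans; apply: le_esum => i _ /=.
by rewrite lee_fin ger0_norm ?pos_ge0 // ge_max ler_norm normr_ge0.
Qed.

Let pos_fin f : rsummable f ->
  \esum_(i in [set: I]) (pos f i)%:E \is a fin_num.
Proof.
move=> /pos_summable; rewrite /rsummable summableE; congr (_ \is a _).
by apply: eq_esum => i _ /=; rewrite ger0_norm.
Qed.

Let opp_summable f : rsummable f -> rsummable (fun i => - f i).
Proof. by rewrite /rsummable summableN. Qed.

Lemma rsumD f g : rsummable f -> rsummable g ->
  rsum (fun i => f i + g i) = rsum f + rsum g.
Proof.
move=> sf sg.
rewrite {1}(pos_sub f) {1}(pos_sub g).
pose f' i := - f i; pose g' i := - g i.
have sf' : rsummable f' by exact: opp_summable.
have sg' : rsummable g' by exact: opp_summable.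
rewrite [LHS](_ : _ = rsum (fun i =>
  (pos f i + pos g i) - (pos f' i + pos g' i))); last first.
  by congr rsum; apply/funext => i; ring.
have E h k : rsummable h -> rsummable k ->
  fine (\esum_(i in [set: I]) (pos h i + pos k i)%:E) =
  fine (\esum_(i in [set: I]) (pos h i)%:E) +
  fine (\esum_(i in [set: I]) (pos k i)%:E).
  move=> sh sk; rewrite -fineD ?pos_fin // -esumD // => i _; exact: pos_ge0.
rewrite (@rsum_subE (fun i => pos f i + pos g i)
  (fun i => pos f' i + pos g' i)).
- by rewrite (E f g) // (E f' g') // opprD addrACA.
- by move=> i; rewrite addr_ge0.
- by move=> i; rewrite addr_ge0.
- by apply: (@summableD _ _ _ (EFin \o pos f) (EFin \o pos g));
    exact: pos_summable.
- by apply: (@summableD _ _ _ (EFin \o pos f') (EFin \o pos g'));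
    exact: pos_summable.
Qed.

Lemma rsumN f : rsum (fun i => - f i) = - rsum f.
Proof.
rewrite /rsum opprB; congr (_ - fine _).
by apply: eq_esum => i _; rewrite opprK.
Qed.

Lemma esumZl k f : 0 <= k -> (forall i, 0 <= f i) ->
  (\esum_(i in [set: I]) (k * f i)%:E =
    k%:E * \esum_(i in [set: I]) (f i)%:E)%E.
Proof.
have le (c : R) (h : I -> R) : 0 <= c -> (forall i, 0 <= h i) ->
  (\esum_(i in [set: I]) (c * h i)%:E <=
    c%:E * \esum_(i in [set: I]) (h i)%:E)%E.
  move=> c0 h0; apply: ge_ereal_sup => _ [A AI <-].
  under eq_fsbigr => i _ do rewrite EFinM.
  rewrite -ge0_mule_fsumr; last by move=> i; rewrite lee_fin.
  apply: lee_pmul => //.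
    by apply: fsume_ge0 => i _; rewrite lee_fin.
  by apply: esum_ge; exists A.
move=> k0 f0; apply/eqP; rewrite eq_le le //=.
have [->|kn0] := eqVneq k 0.
  by rewrite mul0e; apply: esum_ge0 => i _; rewrite mul0r.
(* The converse inequality is the one just proved, for the factor k^-1. *)
rewrite (eq_esum (b := fun i => (k^-1 * (k * f i))%:E)); last first.
  by move=> i _; rewrite mulKf.
apply: (@le_trans _ _
  (k%:E * (k^-1%:E * \esum_(i in [set: I]) (k * f i)%:E)))%E.
  rewrite lee_pmul2l ?lte_fin ?lt_def ?kn0 // le ?invr_ge0 // => i.
  by rewrite mulr_ge0.
by rewrite muleA -EFinM mulfV // mul1e.
Qed.

Lemma rsumZ k f : rsummable f -> rsum (fun i => k * f i) = k * rsum f.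
Proof.
move=> sf.
wlog k0 : k / 0 <= k => [pk|].
  have [/pk//|k0] := leP 0 k.
  rewrite -[k]opprK mulNr -pk ?oppr_ge0 ?ltW // -rsumN.
  by congr rsum; apply/funext => i; rewrite mulNr.
have E h : rsummable h ->
  fine (\esum_(i in [set: I]) (Num.max (k * h i) 0)%:E) =
  k * fine (\esum_(i in [set: I]) (pos h i)%:E).
  move=> sh; rewrite (eq_esum (b := fun i => (k * pos h i)%:E)); last first.
    by move=> i _; rewrite /pos maxr_pMr // mulr0.
  by rewrite esumZl // fineM ?pos_fin.
rewrite /rsum E // mulrBr; congr (_ - _).
rewrite -(E (fun i => - f i)); last exact: opp_summable.
by congr fine; apply: eq_esum => i _; rewrite mulrN.
Qed.

End RealSums.

Lemma csumP (R : realType) (I : choiceType) (a : R[i]) (f g : I -> R[i]) :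
  let summableRe h := summable [set: I] (EFin \o (fun i => complex.Re (h i))) in
  let summableIm h := summable [set: I] (EFin \o (fun i => complex.Im (h i))) in
  summableRe f -> summableIm f -> summableRe g -> summableIm g ->
  csum (fun i => a * f i + g i) = a * csum f + csum g.
Proof.
move=> sRe sIm rf sf rg sg; case: a => a b.
have sZ k (h : I -> R) : summable [set: I] (EFin \o h) ->
    summable [set: I] (EFin \o (fun i => k * h i)).
  move=> sh; rewrite /summable (eq_esum (b := fun i => (`|k| * `|h i|)%:E)).
    by rewrite esumZl // lte_mul_pinfty // lee_fin.
  by move=> i _; rewrite /= normrM.
rewrite /csum.
rewrite (_ : (fun i => complex.Re _) = fun i =>
  (a * complex.Re (f i) + (- b) * complex.Im (f i)) + complex.Re (g i));
  last first.
  by apply/funext => i; case: (f i) => ? ?; case: (g i) => ? ? /=; ring.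
rewrite (_ : (fun i => complex.Im _) = fun i =>
  (a * complex.Im (f i) + b * complex.Re (f i)) + complex.Im (g i)); last first.
  by apply/funext => i; case: (f i) => ? ?; case: (g i) => ? ? /=; ring.
have sD (h k : I -> R) : summable [set: I] (EFin \o h) ->
    summable [set: I] (EFin \o k) ->
    summable [set: I] (EFin \o (fun i => h i + k i)) by exact: summableD.
rewrite !rsumD ?rsumZ ?sD ?sZ //.
by congr (_ +i* _); rewrite mulNr.
Qed.

(** * The scalar product and adjoints *)

Section DotLinear.
Variables (R : realType) (I : choiceType).
Implicit Types x y z : l2 R I.

Let normcE (z : R[i]) : normc z ^+ 2 = complex.Re z ^+ 2 + complex.Im z ^+ 2.
Proof. by case: z => a b; rewrite sqr_sqrtr // addr_ge0 // sqr_ge0. Qed.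

Let sq_summable x y :
  summable [set: I] (fun i => (normc (x i) ^+ 2 + normc (y i) ^+ 2)%:E).
Proof.
have sx z : summable [set: I] (fun i => (normc (z i) ^+ 2)%:E).
  have /asboolP := l2_funP z; apply: le_lt_trans; apply: le_esum => i _.
  by rewrite gee0_abs // lee_fin sqr_ge0.
exact: (summableD (sx x) (sx y)).
Qed.

(* Products of square summable families are summable since
   2 |p q| <= p ^ 2 + q ^ 2. *)
Let Re_summable x y :
  summable [set: I] (EFin \o (fun i => complex.Re (x i * (y i)^*))).
Proof.
apply: le_rsummable (sq_summable x y) => i; rewrite !normcE.
case: (x i) => a b; case: (y i) => c d /=; rewrite ler_norml.
have := (sqr_ge0 (a - c), sqr_ge0 (a + c), sqr_ge0 (b - d), sqr_ge0 (b + d)).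
have := (sqr_ge0 a, sqr_ge0 b, sqr_ge0 c, sqr_ge0 d).
by move=> [[[? ?] ?] ?] [[[? ?] ?] ?]; apply/andP; nra.
Qed.

Let Im_summable x y :
  summable [set: I] (EFin \o (fun i => complex.Im (x i * (y i)^*))).
Proof.
apply: le_rsummable (sq_summable x y) => i; rewrite !normcE.
case: (x i) => a b; case: (y i) => c d /=; rewrite ler_norml.
have := (sqr_ge0 (a - d), sqr_ge0 (a + d), sqr_ge0 (b - c), sqr_ge0 (b + c)).
have := (sqr_ge0 a, sqr_ge0 b, sqr_ge0 c, sqr_ge0 d).
by move=> [[[? ?] ?] ?] [[[? ?] ?] ?]; apply/andP; nra.
Qed.


Lemma l2_linE (a : R[i]) x y i : (a *: x + y : l2 R I) i = a * x i + y i.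
Proof. by []. Qed.

Lemma dotPl (a : R[i]) x y z : dot (a *: x + y) z = a * dot x z + dot y z.
Proof.
transitivity (csum (fun i => a * (x i * (z i)^*) + y i * (z i)^*)).
  by congr csum; apply/funext => i; rewrite l2_linE mulrDl mulrA.
by rewrite csumP.
Qed.

Lemma dotC x y : dot y x = (dot x y)^*.
Proof.
rewrite /dot /csum /= -rsumN; congr (_ +i* _); congr rsum;
  by apply/funext => i; case: (x i) => a b; case: (y i) => c d /=; ring.
Qed.

Lemma dotPr (a : R[i]) x y z : dot z (a *: x + y) = a^* * dot z x + dot z y.
Proof. by rewrite dotC dotPl rmorphD rmorphM (dotC x z) (dotC y z). Qed.

End DotLinear.

Section Adjoints.
Variables (R : realType) (I : choiceType).
Implicit Types S T U V : bop R I.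

Lemma adjoint_sym S T : adjoint S T -> adjoint T S.
Proof. by move=> ST x y; rewrite dotC -ST -dotC. Qed.

(** The coordinate of T x at s is the scalar product of T x with the basis
    vector s, hence that of x with S applied to this vector. *)
Lemma adjoint_unique S T U : adjoint S T -> adjoint S U -> T = U.
Proof.
move=> /adjoint_sym TS /adjoint_sym US; apply: val_inj; apply/funext => x.
apply: val_inj; apply/funext => s.
by rewrite -[LHS]dot_ebasis -[RHS]dot_ebasis TS US.
Qed.

Lemma adjointP (a : R[i]) S T U V : adjoint S U -> adjoint T V ->
  adjoint (a *: S + T) (a^* *: U + V).
Proof.
move=> SU TV x y.
rewrite -[(a *: S + T : bop R I) x]/(a *: S x + T x).
rewrite -[(a^* *: U + V : bop R I) y]/(a^* *: U y + V y).
by rewrite dotPl dotPr conjCK SU TV.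
Qed.

End Adjoints.

Section MonotoneAdjoints.
Variable R : realType.
Implicit Types S T U V : mbop R.

Lemma adjoint1 : adjoint (1 : mbop R) (1 : mbop R).
Proof. by []. Qed.

Lemma adjointM S T U V : adjoint S U -> adjoint T V -> adjoint (S * T) (V * U).
Proof.
move=> SU TV x y.
by rewrite -[(S * T) x]/(S (T x)) -[(V * U) y]/(V (U y)) SU TV.
Qed.

Lemma adjoint_prod (J : Type) (F G : J -> mbop R) (s : seq J) :
  (forall j, adjoint (F j) (G j)) ->
  adjoint (\prod_(j <- s) F j) (\prod_(j <- rev s) G j).
Proof.
move=> FG; elim: s => [|j s IHs]; first by rewrite !big_nil; exact: adjoint1.
rewrite big_cons rev_cons big_rcons /=; exact: adjointM.
Qed.

Lemma adjoint_lform (l : incseq * incseq) :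
  adjoint (lform R l) (lform R (l.2, l.1)).
Proof.
case: l => l1 l2; rewrite /lform /=; move: (sval l1) (sval l2) => s t.
have CA i : adjoint (creator R i) (annihilator R i).
  by apply: adjoint_sym; exact: annihilator_adjoint.
have Hs := adjoint_prod s CA.
have Ht := adjoint_prod (rev t) (@annihilator_adjoint R).
rewrite revK in Ht.
exact: adjointM Hs Ht.
Qed.

End MonotoneAdjoints.

Local Notation incr := (sorted (fun i j : int => i < j)).

(** * Coordinates of operators *)

Section Coordinates.
Variable R : realType.
Implicit Types (x y : mfock R) (u v : seq int) (S T : mbop R) (i : int).

(** Indexing by raw sequences, with value 0 at those that do not increase,
    makes the annihilator a mere shift ([fcoord_annihilator]) and spares any
    reasoning on sorting proofs. *)
Definition fcoord x u : R[i] := oapp x 0 (insub u : option incseq).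

Lemma fcoord_val x (s : incseq) : fcoord x (val s) = x s.
Proof. by rewrite /fcoord valK. Qed.

Lemma fcoord_unsorted x u : ~~ incr u -> fcoord x u = 0.
Proof. by move=> nu; rewrite /fcoord insubN. Qed.

Lemma fcoordP x y : (forall u, incr u -> fcoord x u = fcoord y u) -> x = y.
Proof.
move=> xy; apply: val_inj; apply/funext => s.
by rewrite -[LHS]fcoord_val -[RHS]fcoord_val xy // (valP s).
Qed.

Lemma bop_fcoordP S T :
  (forall x u, incr u -> fcoord (S x) u = fcoord (T x) u) -> S = T.
Proof.
by move=> ST; apply: val_inj; apply/funext => x; apply: fcoordP => u; exact: ST.
Qed.

Lemma fcoord_annihilator i x u :
  fcoord (annihilator R i x) u = fcoord x (i :: u).
Proof.
have [u_incr|nu] := boolP (incr u); last first.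
  by rewrite !fcoord_unsorted //; apply: contra nu; exact: path_sorted.
by rewrite /fcoord (insubT (fun s => incr s) u_incr).
Qed.

Lemma fcoord_creator i x u : fcoord (creator R i x) u =
  if u is j :: v then if (j == i) && incr u then fcoord x v else 0 else 0.
Proof.
have [u_incr|nu] := boolP (incr u); last first.
  by rewrite fcoord_unsorted //; case: u nu => // j v nu; rewrite andbF.
rewrite /fcoord (insubT (fun s => incr s) u_incr) /=.
rewrite -[LHS]/(oapp x 0 (uncons_seq i (exist _ u u_incr))) /uncons_seq /=.
case: u u_incr => //= j v u_incr; rewrite andbT.
by case: (j == i).
Qed.

Lemma fcoord_lin (a : R[i]) x y u :
  fcoord (a *: x + y) u = a * fcoord x u + fcoord y u.
Proof.
by rewrite /fcoord; case: insub => [s|] //=; rewrite mulr0 addr0.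
Qed.

Lemma bopE S T x : (S * T) x = S (T x). Proof. by []. Qed.

Lemma fcoord_bopP (a : R[i]) S T x u :
  fcoord ((a *: S + T) x) u = a * fcoord (S x) u + fcoord (T x) u.
Proof. exact: fcoord_lin. Qed.

Lemma fcoord_bop0 x u : fcoord ((0 : mbop R) x) u = 0.
Proof. by rewrite /fcoord; case: insub. Qed.

Lemma fcoord_bopB S T x u :
  fcoord ((S - T) x) u = fcoord (S x) u - fcoord (T x) u.
Proof. by rewrite addrC -scaleN1r fcoord_bopP mulN1r addrC. Qed.

Lemma fcoord_bop_sum (J : Type) (s : seq J) (c : J -> R[i]) (F : J -> mbop R)
    x u :
  fcoord ((\sum_(j <- s) c j *: F j) x) u =
  \sum_(j <- s) c j * fcoord (F j x) u.
Proof.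
elim: s => [|j s IHs]; first by rewrite !big_nil fcoord_bop0.
by rewrite !big_cons fcoord_bopP IHs.
Qed.

Lemma fcoord_ebasis (s : incseq) u : fcoord (ebasis R s) u = (u == val s)%:R.
Proof.
have [u_incr|nu] := boolP (incr u); last first.
  rewrite fcoord_unsorted //; case: eqP => // us.
  by move: nu; rewrite us (valP s).
by rewrite /fcoord (insubT (fun s => incr s) u_incr) /= /delta -val_eqE.
Qed.

Lemma fcoord_annihilators (t : seq int) x u :
  fcoord ((\prod_(j <- rev t) annihilator R j) x) u = fcoord x (t ++ u).
Proof.
elim: t u x => [|j t IHt] u x; first by rewrite big_nil.
by rewrite rev_cons big_rcons bopE IHt fcoord_annihilator.
Qed.

Lemma fcoord_creators (s : seq int) x u :
  fcoord ((\prod_(i <- s) creator R i) x) u =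
  if prefix s u && incr u then fcoord x (drop (size s) u) else 0.
Proof.
elim: s u => [|i s IHs] u.
  by rewrite big_nil prefix0s drop0 /=; case: ifPn => // /fcoord_unsorted ->.
rewrite big_cons bopE fcoord_creator; case: u => [|j u] //.
rewrite prefix_cons IHs eq_sym; case: eqP => //= _.
case: ifPn => [ju|]; last by rewrite andbF.
by rewrite (path_sorted ju).
Qed.

End Coordinates.

(** * Finite linear combinations of a family *)

Section LinearSpan.
Variables (K : fieldType) (V : lmodType K) (J : eqType) (v : J -> V).

(** Lists of coefficient-index pairs, repetitions allowed, concatenate without
    any bookkeeping. *)
Definition lin_span : set V :=
  [set x | exists L : seq (K * J), x = \sum_(p <- L) p.1 *: v p.2].

Lemma lin_span0 : lin_span 0.
Proof. by exists [::]; rewrite big_nil. Qed.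

Lemma lin_span_gen j : lin_span (v j).
Proof. by exists [:: (1, j)]; rewrite big_seq1 scale1r. Qed.

Lemma lin_spanP (a : K) x y :
  lin_span x -> lin_span y -> lin_span (a *: x + y).
Proof.
move=> [L ->] [L' ->]; exists ([seq (a * p.1, p.2) | p <- L] ++ L').
rewrite big_cat big_map scaler_sumr; congr (_ + _).
by apply: eq_bigr => p _; rewrite scalerA.
Qed.

Lemma lin_spanB x y : lin_span x -> lin_span y -> lin_span (x - y).
Proof. by move=> sx sy; rewrite addrC -scaleN1r; exact: lin_spanP. Qed.

(** Repeated indices are merged by adding up their coefficients. *)
Lemma lin_span_family x : lin_span x ->
  exists (s : seq J) (c : J -> K), x = \sum_(j <- s) c j *: v j.
Proof.
move=> [L ->]; pose s := undup [seq p.2 | p <- L].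
exists s, (fun j => \sum_(p <- L | p.2 == j) p.1).
under [RHS]eq_bigr => j _ do rewrite scaler_suml.
rewrite (exchange_big_dep xpredT) //= big_seq [RHS]big_seq.
apply: eq_bigr => p pL; rewrite -big_filter (eq_filter (a2 := pred1 p.2)).
  by rewrite filter_pred1_uniq ?undup_uniq ?big_seq1 // mem_undup; exact: map_f.
by move=> j /=; rewrite eq_sym.
Qed.

End LinearSpan.

(** * Relations between creators and annihilators *)

Section Relations.
Variable R : realType.
Implicit Types (i j k : int) (s t : seq int).

Local Notation ann := (annihilator R).
Local Notation cre := (creator R).

(** The projection onto the span of the basis vectors whose entries all exceed
    i, the vacuum included; see [fcoord_vac_proj]. *)
Definition vac_proj i : mbop R := ann i * cre i.

(** The words of [lform], for sequences s and t that need not increase. All the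
    additional words vanish ([word_unsorted]), so that [creator_word] and
    [annihilator_word] hold without side conditions. *)
Definition word s t : mbop R :=
  (\prod_(i <- s) cre i) * (\prod_(j <- rev t) ann j).

Lemma fcoord_word s t x u : fcoord (word s t x) u =
  if prefix s u && incr u then fcoord x (t ++ drop (size s) u) else 0.
Proof. by rewrite bopE fcoord_creators fcoord_annihilators. Qed.

Lemma fcoord_vac_proj i x u : fcoord (vac_proj i x) u =
  if incr (i :: u) then fcoord x u else 0.
Proof. by rewrite bopE fcoord_annihilator fcoord_creator eqxx. Qed.

(** A nonzero entry of the word (s, t) sits at (s ++ v, t ++ v) for some v, and
    both sequences must increase. *)
Lemma word_unsorted s t : ~~ (incr s && incr t) -> word s t = 0.
Proof.
move=> nst; apply: bop_fcoordP => x u _; rewrite fcoord_word fcoord_bop0.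
case: ifPn => // /andP[/prefixP[u' ->]]; rewrite drop_size_cat //.
move=> /cat_sorted2[s_incr _]; apply: fcoord_unsorted.
by apply: contra nst => /cat_sorted2[-> _]; rewrite s_incr.
Qed.

Lemma creator_word i s t : cre i * word s t = word (i :: s) t.
Proof. by rewrite /word big_cons mulrA. Qed.

Lemma annihilator_word i t : ann i * word [::] t = word [::] (rcons t i).
Proof. by rewrite /word big_nil !mul1r rev_rcons big_cons. Qed.

(** A basis vector starts with i + 1 exactly when its entries exceed i but not
    all exceed i + 1. *)
Lemma number_telescope i :
  cre (i + 1) * ann (i + 1) = vac_proj i - vac_proj (i + 1).
Proof.
apply: bop_fcoordP => x u u_incr.
rewrite fcoord_bopB !fcoord_vac_proj bopE fcoord_creator.
case: u u_incr => [|j v] jv; first by rewrite subrr.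
rewrite jv fcoord_annihilator andbT /= [path _ _ _]jv !andbT.
have [->|ij] := eqVneq j (i + 1); first by rewrite ltrDl ltr01 ltxx subr0.
have -> : (i < j) = (i + 1 < j) by lia.
by rewrite subrr.
Qed.

Lemma vac_proj_creator i j s t : vac_proj i * word (j :: s) t =
  if i < j then word (j :: s) t else 0.
Proof.
apply: bop_fcoordP => x u u_incr; rewrite bopE fcoord_vac_proj.
case: u u_incr => [|k v] kv; first by rewrite fcoord_word; case: ifP => _;
  rewrite ?fcoord_word ?fcoord_bop0.
rewrite (fun_if (fun T : mbop R => fcoord (T x) (k :: v))).
rewrite fcoord_bop0 fcoord_word.
rewrite prefix_cons kv /= [path _ _ _]kv !andbT.
have [->|] := eqVneq j k; rewrite /= ?if_same //; by case: (_ < _).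
Qed.

Lemma vac_proj_annihilator i j t : i <= j ->
  vac_proj i * word [::] (rcons t j) = word [::] (rcons t j).
Proof.
move=> ij; apply: bop_fcoordP => x u u_incr.
rewrite bopE fcoord_vac_proj fcoord_word /= prefix0s u_incr drop0.
case: ifPn => // niu; apply/esym/fcoord_unsorted; apply: contra niu.
rewrite cat_rcons => /cat_sorted2[_].
by case: u {u_incr} => //= k v /andP[jk ->]; rewrite (le_lt_trans ij jk).
Qed.

Lemma annihilator_vac_proj i j :
  ann i * vac_proj j = if j < i then ann i else 0.
Proof.
apply: bop_fcoordP => x u u_incr.
rewrite bopE fcoord_annihilator fcoord_vac_proj.
rewrite (fun_if (fun T : mbop R => fcoord (T x) u)).
rewrite fcoord_annihilator fcoord_bop0.
have [iu|niu] := boolP (incr (i :: u)).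
  by rewrite /= [path _ _ _]iu andbT.
rewrite /= (negPf niu : path _ _ _ = false) andbF.
by rewrite fcoord_unsorted // if_same.
Qed.

Lemma creator_vac_proj i j : j <= i -> cre i * vac_proj j = cre i.
Proof.
move=> ji; apply: bop_fcoordP => x u u_incr; rewrite bopE !fcoord_creator.
case: u u_incr => // k v kv; rewrite kv andbT; case: eqP => // ki.
rewrite fcoord_vac_proj; case: ifPn => // /negP; case.
by case: v kv => //= l v; rewrite ki => /andP[il ->]; rewrite (le_lt_trans ji).
Qed.

Lemma annihilator_creator_neq i j : i != j -> ann i * cre j = 0.
Proof.
move=> ij; apply: bop_fcoordP => x u u_incr.
by rewrite bopE fcoord_annihilator fcoord_creator (negPf ij) fcoord_bop0.
Qed.

End Relations.

(** * The span is a unital *-subalgebra *)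

Section Span.
Variable R : realType.
Implicit Types (i j k : int) (s t : seq int) (A B T : mbop R).

Local Notation ann := (annihilator R).
Local Notation cre := (creator R).

Definition basis_family (j : Gamma + int) : mbop R :=
  match j with
  | inl l => lform R (val l)
  | inr i => vac_proj R i
  end.

Definition basis_span : set (mbop R) := lin_span basis_family.

Lemma basis_span_vac_proj i : basis_span (vac_proj R i).
Proof. exact: (lin_span_gen basis_family (inr i)). Qed.

(** The words outside the family are those that vanish and the number operators,
    which are differences of two projections. *)
Lemma basis_span_word s t : basis_span (word R s t).
Proof.
have [/andP[s_incr t_incr]|nst] := boolP (incr s && incr t); last first.
  by rewrite word_unsorted //; exact: lin_span0.
pose l : incseq * incseq := (exist _ s s_incr, exist _ t t_incr).
have [lG|] := boolP (in_Gamma l).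
  exact: (lin_span_gen basis_family (inl (exist _ l lG))).
rewrite /in_Gamma /=; case: s {s_incr l} => [|i [|? ?]] //.
case: t {t_incr} => [|j [|? ?]] //; rewrite negbK => /eqP <-.
rewrite /word !big_seq1 -(subrK 1 i) number_telescope.
by apply: lin_spanB; exact: basis_span_vac_proj.
Qed.

(** P_j is P_i minus the number operators at i + 1, ..., j. *)
Lemma basis_span_telescope A B i j :
  i <= j -> basis_span (A * vac_proj R i * B) ->
  (forall k, basis_span (A * (cre k * ann k) * B)) ->
  basis_span (A * vac_proj R j * B).
Proof.
move=> ij Pi Q.
have [n ->] : exists n : nat, j = i + n%:Z.
  by exists (absz (j - i)); lia.
elim: n => [|n IHn]; first by rewrite addr0.
rewrite (_ : vac_proj R _ = vac_proj R (i + n%:Z) -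
    cre (i + n%:Z + 1) * ann (i + n%:Z + 1)).
  by rewrite mulrBr mulrBl; apply: lin_spanB IHn (Q _).
by rewrite number_telescope subKr; congr vac_proj; lia.
Qed.

Lemma basis_span_creatorM i x : basis_span x -> basis_span (cre i * x).
Proof.
move=> [L ->]; rewrite mulr_sumr.
elim: L => [|[a [l|j]] L IHL]; first by rewrite big_nil; exact: lin_span0.
  rewrite big_cons -scalerAr; apply: lin_spanP => //=.
  by rewrite creator_word; exact: basis_span_word.
rewrite big_cons -scalerAr; apply: lin_spanP => //=.
have cW : cre i = word R [:: i] [::] by rewrite /word big_seq1 big_nil mulr1.
(* The creator at i kills every basis vector with an entry <= i, so P_j is
   absorbed for j <= i; otherwise the telescoping descends to P_i. *)
have [ji|/ltW ij] := leP j i.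
  by rewrite [_ * (_ * _)]creator_vac_proj // cW; exact: basis_span_word.
rewrite -[_ * (_ * _)]mulr1; apply: (basis_span_telescope ij).
  by rewrite creator_vac_proj // mulr1 cW; exact: basis_span_word.
move=> k; rewrite mulr1 mulrA (_ : _ * _ * _ = word R [:: i; k] [:: k]).
  exact: basis_span_word.
by rewrite /word !big_cons !big_nil !mulr1.
Qed.

(** A leading creator of the word meets the new annihilator: the product is 0 or
    starts with a projection, to be combined with the rest of the word. *)
Lemma basis_span_annihilatorM i x : basis_span x -> basis_span (ann i * x).
Proof.
move=> [L ->]; rewrite mulr_sumr.
elim: L => [|[a b] L IHL]; first by rewrite big_nil; exact: lin_span0.
rewrite big_cons -scalerAr; apply: lin_spanP => //= {L IHL}.
case: b => [l|j].
  rewrite -[basis_family _]/(word R (val (val l).1) (val (val l).2)).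
  move: (val (val l).1) (val (val l).2) => s t; case: s => [|j s].
    by rewrite annihilator_word; exact: basis_span_word.
  rewrite -creator_word mulrA; have [<-|ij] := eqVneq i j; last first.
    by rewrite annihilator_creator_neq // mul0r; exact: lin_span0.
  rewrite -/(vac_proj R i); case: s => [|k s].
    case: (lastP t) => [|t' k].
      rewrite /word !big_nil !mulr1; exact: basis_span_vac_proj.
    (* A basis vector on which the word does not vanish starts with t' and k,
       hence continues above k: P_i is absorbed for i <= k. *)
    have [ik|/ltW ki] := leP i k.
      by rewrite vac_proj_annihilator //; exact: basis_span_word.
    rewrite -[vac_proj R i]mul1r; apply: (basis_span_telescope ki).
      by rewrite mul1r vac_proj_annihilator //; exact: basis_span_word.
    move=> m; rewrite mul1r -mulrA annihilator_word creator_word.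
    exact: basis_span_word.
  rewrite vac_proj_creator; case: ifP => _; last exact: lin_span0.
  exact: basis_span_word.
rewrite [_ * (_ * _)]annihilator_vac_proj.
case: ifP => _; last exact: lin_span0.
rewrite (_ : ann i = word R [::] [:: i]); first exact: basis_span_word.
by rewrite /word big_seq1 big_nil mul1r.
Qed.

Lemma basis_span_wordM s t x : basis_span x -> basis_span (word R s t * x).
Proof.
move=> Sx; elim: s => [|i s IHs]; last first.
  by rewrite -creator_word -mulrA; exact: basis_span_creatorM.
elim/last_ind: t => [|t i IHt]; first by rewrite /word !big_nil !mul1r.
by rewrite -annihilator_word -mulrA; exact: basis_span_annihilatorM.
Qed.

Lemma basis_spanM x y : basis_span x -> basis_span y -> basis_span (x * y).
Proof.
move=> [L ->] Sy; rewrite mulr_suml.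
elim: L => [|[a b] L IHL]; first by rewrite big_nil; exact: lin_span0.
rewrite big_cons -scalerAl; apply: lin_spanP => //= {L IHL}.
case: b => [l|j] /=; first exact: basis_span_wordM.
by rewrite -mulrA; apply: basis_span_annihilatorM; exact: basis_span_creatorM.
Qed.

(** By uniqueness of the adjoint, it is enough to exhibit one adjoint in the
    span for each combination of basis elements. *)
Lemma basis_span_adjoint x y : basis_span x -> adjoint x y -> basis_span y.
Proof.
move=> [L ->] xy; suff [z Sz xz] : exists2 z, basis_span z &
    adjoint (\sum_(p <- L) p.1 *: basis_family p.2 : mbop R) z.
  by rewrite (adjoint_unique xy xz).
elim: L {x y xy} => [|[a b] L [z Sz Lz]].
  exists 0; first exact: lin_span0.
  rewrite big_nil; have := adjointP (-1) (@adjoint1 R) (@adjoint1 R).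
  by rewrite rmorphN1 scaleN1r addNr.
rewrite big_cons /=; suff [w Sw bw] : exists2 w,
    basis_span w & adjoint (basis_family b) w.
  by exists (a^*%R *: w + z); [exact: lin_spanP|exact: adjointP].
case: b => [l|j].
  exists (lform R ((val l).2, (val l).1)); first exact: basis_span_word.
  exact: adjoint_lform.
exists (vac_proj R j); first exact: basis_span_vac_proj.
apply: adjointM; first exact: annihilator_adjoint.
by apply: adjoint_sym; exact: annihilator_adjoint.
Qed.

Lemma unital_star_subalgebra_basis_span : unital_star_subalgebra basis_span.
Proof.
split.
- have -> : (1 : mbop R) = word R [::] [::] by rewrite /word !big_nil mulr1.
  exact: basis_span_word.
- by move=> a x y; exact: lin_spanP.
- exact: basis_spanM.
- exact: basis_span_adjoint.
Qed.

Lemma monotone_algebra_basis_span : (@monotone_algebra R) `<=` basis_span.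
Proof.
apply: smallest_sub; first exact: unital_star_subalgebra_basis_span.
move=> _ [i _ <-].
have -> : ann i = word R [::] [:: i] by rewrite /word big_seq1 big_nil mul1r.
exact: basis_span_word.
Qed.

Lemma basis_family_in (j : Gamma + int) : monotone_algebra (basis_family j).
Proof.
move=> S [[S1 Slin SM Sadj] Sann].
have Sa i : S (ann i) by apply: Sann; exists i.
have Sc i : S (cre i) by apply: Sadj (Sa i) _; exact: annihilator_adjoint.
have Sprod (F : int -> mbop R) (s : seq int) : (forall i, S (F i)) ->
    S (\prod_(i <- s) F i).
  move=> SF; elim: s => [|i s IHs]; first by rewrite big_nil.
  by rewrite big_cons; exact: SM.
by case: j => [l|i]; apply: SM => //; exact: Sprod.
Qed.

End Span.

(** * Linear independence *)

Lemma sum_select (K : nzRingType) (J : eqType) (L : seq J) (c d : J -> K)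
    (j0 : J) :
  uniq L -> j0 \in L -> d j0 = 1 ->
  {in L, forall j, j != j0 -> c j * d j = 0} ->
  \sum_(j <- L) c j * d j = c j0.
Proof.
move=> uL j0L dj0 d0; rewrite (bigD1_seq j0) //= dj0 mulr1.
by rewrite big_seq_cond big1 ?addr0 // => j /andP[]; exact: d0.
Qed.

Section Independence.
Variable R : realType.
Implicit Types (l : Gamma) (j : Gamma + int).

(** The matrix entry of a basis element in row s and column t, which is always 0
    or 1 ([mentryE]). *)
Definition mentry j (s t : incseq) : bool :=
  match j with
  | inl l => prefix (val (val l).1) (val s) &&
      (val (val l).2 ++ drop (size (val (val l).1)) (val s) == val t)
  | inr i => incr (i :: val s) && (s == t)
  end.

Lemma mentryE j s t :
  fcoord (basis_family R j (ebasis R t)) (val s) = (mentry j s t)%:R.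
Proof.
case: j => [l|i] /=.
  by rewrite fcoord_word (valP s) andbT fcoord_ebasis; case: prefix.
by rewrite fcoord_vac_proj fcoord_ebasis val_eqE /=; case: path.
Qed.

Definition single (k : int) : incseq := exist _ [:: k] isT.

(** The exclusion of the number operators enters here: apart from the identity,
    the number operator at k is the only word with a nonzero entry at
    ([:: k], [:: k]), and it would make this entry depend on k. *)
Lemma mentry_single l k : mentry (inl l) (single k) (single k) =
  (val (val l).1 == [::]) && (val (val l).2 == [::]).
Proof.
case: l => -[[s s_incr] [t t_incr]] /=; rewrite /in_Gamma /=.
case: s s_incr => [|i [|? s]] //= _.
  by case: t t_incr => [|j [|? ?]] //= _ _; rewrite ?eqxx // eqseq_cons andbF.
rewrite andbT; case: t t_incr => [|j [|? ?]] //= _ ij.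
- by rewrite andbF.
- rewrite eqseq_cons andbT; apply/negP => /andP[/eqP ik /eqP jk].
  by move: ij; rewrite ik jk eqxx.
- by rewrite eqseq_cons !andbF.
by rewrite andbF.
Qed.

Lemma basis_family_free (L : seq (Gamma + int)) (c : Gamma + int -> R[i]) :
  uniq L -> \sum_(j <- L) c j *: basis_family R j = 0 ->
  forall j, j \in L -> c j = 0.
Proof.
move=> uL sum0.
have entry0 s t : \sum_(j <- L) c j * (mentry j s t)%:R = 0.
  under eq_bigr => j _ do rewrite -mentryE.
  by rewrite -fcoord_bop_sum sum0 fcoord_bop0.
(* P_i contributes at [:: k + 1] but not at [:: k] only for i = k. *)
have cP k : inr k \in L -> c (inr k) = 0.
  move=> kL; pose d j : R[i] :=
    (mentry j (single (k + 1)) (single (k + 1)))%:R -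
    (mentry j (single k) (single k))%:R.
  rewrite -(@sum_select _ _ L c d (inr k)) //.
  - under eq_bigr => j _ do rewrite mulrBr.
    by rewrite sumrB !entry0 subrr.
  - by rewrite /d /= !eqxx !andbT ltrDl ltr01 ltxx subr0.
  move=> [l|i] _ ik; rewrite /d; first by rewrite !mentry_single subrr mulr0.
  rewrite /= !eqxx !andbT (_ : (i < k + 1) = (i < k)) ?subrr ?mulr0 //.
  have : i != k by apply: contraNN ik => /eqP ->.
  by move=> ?; lia.
(* A word other than (s, t) with a nonzero entry at (s, t) is obtained by
   deleting a nonempty common tail, so it has fewer creators. *)
have cL n l : size (val (val l).1) = n -> inl l \in L -> c (inl l) = 0.
  elim/ltn_ind: n l => n IHn l sl lL.
  rewrite -(@sum_select _ _ L c
    (fun j => (mentry j (val l).1 (val l).2)%:R) (inl l)) //.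
    by rewrite /= prefix_refl drop_size cats0 eqxx.
  move=> [l'|i] jL jl; last by rewrite cP // mul0r.
  have [|_] := boolP (mentry _ _ _); last by rewrite mulr0.
  move=> /andP[/prefixP[v sv]]; rewrite sv drop_size_cat // => /eqP tv.
  rewrite mulr1; apply: (IHn (size (val (val l').1))) => //.
  rewrite -sl sv size_cat -[X in (X < _)%N]addn0 ltn_add2l lt0n size_eq0.
  apply: contra jl => /eqP v0; apply/eqP; congr inl; apply: val_inj.
  rewrite [val l']surjective_pairing [RHS]surjective_pairing.
  by congr pair; apply: val_inj; rewrite -?sv -?tv ?sv v0 cats0.
by case=> [l|k] jL; [exact: cL jL|exact: cP].
Qed.

End Independence.

Theorem theorem3p4 (R : realType) :
  hamel_basis (@monotone_algebra R)
    (fun j : Gamma + int =>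
       match j with
       | inl l => lform R (val l)
       | inr i => annihilator R i * creator R i
       end).
Proof.
split.
- exact: basis_family_in.
- by move=> s c us; exact: basis_family_free.
- by move=> x /monotone_algebra_basis_span /lin_span_family.
Qed.
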